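(* Let $(X,d)$ be a metric space with at least three points, let $k$ be a positive integer, and suppose that $0<s<t$. Then $\dim^s_k(X)\geq \dim^t_k(X)\geq \dim_k(X)$. However, it can happen that $\lim_{t\to+\infty}\dim^t_k(X) > \dim_k(X)$; that is, there exist a metric space $(X,d)$ and a positive integer $k$ for which this strict inequality holds.
   Context: For a metric space $(X,d)$ and a positive integer $k$, a subset $S\subset X$ is a $k$-metric generator for $(X,d)$ if for any two distinct points $u,v\in X$ there are at least $k$ distinct points $w\in S$ with $d(u,w)\neq d(v,w)$. $\dim_k(X)$ is the infimum of $|S|$ over all $k$-metric generators $S$ for $(X,d)$ (with $|S|=+\infty$ for infinite $S$ and $\inf\varnothing=+\infty$). For real $t>0$, $d^t$ is the metric on $X$ given by $d^t(x,y)=\min\{d(x,y),2t\}$, and $\dim^t_k(X)$ denotes the $k$-metric dimension of $(X,d^t)$. Dimensions take values in $\{0,1,2,\ldots\}\cup\{+\infty\}$, and the limit is taken in this extended sense. *)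

(* Defs.v *)
From HB Require Import structures.
From mathcomp Require Import all_boot all_order all_algebra.
From mathcomp Require Import all_classical all_reals all_analysis.

Set Implicit Arguments.
Unset Strict Implicit.
Unset Printing Implicit Defensive.

Import Order.TTheory GRing.Theory Num.Theory.

Local Open Scope classical_set_scope.
Local Open Scope card_scope.
Local Open Scope ring_scope.

(* Generators and dimensions are defined for a distance function [d] rather
   than for a [metricType], so that one carrier can be used with [mdist] and
   with all its truncations. *)
Definition metric_generator (R : realType) (X : choiceType)
    (d : X -> X -> R) (k : nat) (S : set X) : Prop :=
  forall u v : X, u <> v -> `I_k #<= [set w | S w /\ d u w <> d v w].

(* [counting S] is the number of points of [S], +oo when [S] is infinite, and
   [ereal_inf set0 = +oo]. *)
Definition metric_dim (R : realType) (X : choiceType)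
    (d : X -> X -> R) (k : nat) : \bar R :=
  ereal_inf [set counting S | S in metric_generator d k].

Definition trunc_dist (R : realType) (X : Type) (t : R) (d : X -> X -> R)
    (x y : X) : R :=
  Num.min (d x y) (2 * t).

Lemma trunc_dist_metric (R : realType) (X : metricType R) (t : R) :
  0 < t ->
  let dt := trunc_dist t (@mdist R X) in
  [/\ forall x, dt x x = 0,
      forall x y, dt x y = 0 -> x = y,
      forall x y, dt x y = dt y x
    & forall y x z, dt x z <= dt x y + dt y z].
Proof.
move=> t0 /=; have t20 : 0 < 2 * t by rewrite mulr_gt0.
rewrite /trunc_dist; split.
- by move=> x; rewrite mdistxx; apply/min_idPl/ltW.
- move=> x y; rewrite minEle; case: ifP => _; first exact: mdist_positivity.
  by move=> t2; rewrite t2 ltxx in t20.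
- by move=> x y; rewrite metric_sym.
- move=> y x z.
  have min_ge0 a b : 0 <= Num.min (@mdist R X a b) (2 * t).
    by rewrite le_min mdist_ge0 ltW.
  have [xy|xy] := leP (mdist x y) (2 * t); last first.
    by rewrite ge_min lerDl min_ge0 orbT.
  have [yz|yz] := leP (mdist y z) (2 * t).
    by rewrite ge_min metric_triangle.
  by rewrite ge_min lerDr mdist_ge0 orbT.
Qed.

(* Main.v *)
(* Lowering the truncation level factors through the higher one, since
   min(d, 2s) = min(min(d, 2t), 2s) for s <= t, so a pair of points separated by
   [w] for the coarser distance is separated by [w] for the finer one; this gives
   the monotonicity.  For the strict inequality take the real line with k = 1:
   {0, 1} is a generator, but after truncation all points far away from a finite
   set have the same distance to each of its elements, so every truncated
   dimension is +oo. *)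

Require Import Defs.
From HB Require Import structures.
From mathcomp Require Import all_boot all_order all_algebra.
From mathcomp Require Import all_classical all_reals all_analysis.
From mathcomp Require Import lra.

Set Implicit Arguments.
Unset Strict Implicit.
Unset Printing Implicit Defensive.

Import Order.TTheory GRing.Theory Num.Theory.
Import numFieldNormedType.Exports.

Local Open Scope classical_set_scope.
Local Open Scope card_scope.
Local Open Scope ring_scope.

(** The hypothesis makes every point that separates [u] and [v] for [d] separate them for [d'], so
    the infimum for [d'] runs over at least as many generators. *)
Lemma le_metric_dim (R : realType) (X : choiceType) (d d' : X -> X -> R)
    (k : nat) :
  (forall u v w, d' u w = d' v w -> d u w = d v w) ->
  (metric_dim d' k <= metric_dim d k)%E.
Proof.
move=> dd'; apply: ereal_inf_le_tmp; apply: image_subset => S dS u v uv.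
apply: card_le_trans (dS u v uv) _; apply: subset_card_le => w [Sw duvw].
by split=> // /dd'.
Qed.

Lemma trunc_dist_trunc (R : realType) (X : Type) (s t : R) (d : X -> X -> R)
    (x y : X) :
  s <= t -> trunc_dist s d x y = Num.min (trunc_dist t d x y) (2 * s).
Proof.
by move=> st; rewrite /trunc_dist -minA (min_r (x := 2 * t))// ler_pM2l.
Qed.

Lemma card_ge1P (T : Type) (A : set T) : reflect (A !=set0) (`I_1 #<= A).
Proof.
apply: (iffP idP) => [A1|[x Ax]].
  apply/set0P/eqP => A0; move: A1.
  by rewrite A0 card_le0 II1 => /eqP/seteqP[/(_ 0%N erefl)].
by rewrite -(card_le_eql (@card_set1 T x)); apply: subset_card_le => _ ->.
Qed.

Lemma generator01 (R : realType) :
  metric_generator (@mdist R R^o) 1 [set 0; 1].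
Proof.
move=> u v uv; apply/card_ge1P.
have [/eqP uv0|/eqP uv0] := eqVneq (@mdist R R^o u 0) (@mdist R R^o v 0).
  exists 1; split; first by right.
  (* Equal distances to 0 leave only [u = - v]; equal distances to 1 would then force [u = v] or
     [u + v = 2], and the latter contradicts [u = - v]. *)
  move=> /eqP; move: uv0; rewrite /mdist/= !sub0r !normrN !eqr_norm2.
  move=> /orP[/eqP//|/eqP uNv] /orP[] /eqP u1v; apply: uv; lra.
by exists 0; split; [left|].
Qed.

Lemma metric_dim_real_lty (R : realType) :
  (metric_dim (@mdist R R^o) 1 < +oo)%E.
Proof.
apply: (@le_lt_trans _ _ (counting ([set 0; 1] : set R^o))).
  by apply: ereal_inf_lbound; exists [set 0; 1] => //; exact: generator01.
by rewrite /counting asboolT ?ltry//; exact: finite_set2.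
Qed.

Lemma metric_dim_trunc_real (R : realType) (t : R) :
  metric_dim (trunc_dist t (@mdist R R^o)) 1 = +oo%E.
Proof.
apply/ereal_inf_pinfty => _ [S genS <-]; rewrite /= /counting.
case: asboolP => // finS; exfalso.
have [M [_ bndS]] := compact_bounded (finite_compact finS).
(* Boundedness is only asserted for radii strictly above [M]. *)
pose r := `|M| + 1.
have Sr w : S w -> `|w| <= r.
  by apply: bndS; rewrite /r (le_lt_trans (ler_norm M))// ltrDl.
(* Points from [u] on lie at distance at least [2 * t] from [S], so [S] cannot separate [u] from
   [u + 1]. *)
pose u : R^o := r + `|2 * t|.
have farS (x w : R^o) : u <= x -> S w ->
      trunc_dist t (@mdist R R^o) x w = 2 * t.
  move=> ux /Sr /(le_trans (ler_norm w)) wr; apply/min_idPr.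
  rewrite /mdist/= distrC (le_trans _ (ler_norm _))//.
  have := ler_norm (2 * t); move: ux; rewrite /u; lra.
have uu1 : u <> u + 1 by lra.
have /card_ge1P[w [Sw]] := genS _ _ uu1.
by rewrite !farS// lerDl.
Qed.

Theorem theorem8p1 (R : realType) :
  (forall (X : metricType R) (k : nat) (s t : R),
      `I_3 #<= [set: X] -> (0 < k)%N -> 0 < s -> s < t ->
      (metric_dim (trunc_dist s (@mdist R X)) k
         >= metric_dim (trunc_dist t (@mdist R X)) k)%E /\
      (metric_dim (trunc_dist t (@mdist R X)) k
         >= metric_dim (@mdist R X) k)%E)
  /\
  (exists (X : metricType R) (k : nat),
      [/\ (0 < k)%N,
          cvg (metric_dim (trunc_dist t (@mdist R X)) k @[t --> +oo%R])
        & (lim (metric_dim (trunc_dist t (@mdist R X)) k @[t --> +oo%R])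
             > metric_dim (@mdist R X) k)%E]).
Proof.
split=> [X k s t _ _ _ /ltW st|].
  split; apply: le_metric_dim => u v w; last by rewrite /trunc_dist => ->.
  by rewrite !(trunc_dist_trunc _ _ _ st) => ->.
(* The truncated dimension is +oo for every real [t], whatever its sign, so the limit is that of a
   constant function. *)
exists R^o, 1%N; under eq_fun do rewrite metric_dim_trunc_real.
split=> //; first exact: is_cvg_cst.
by rewrite lim_cst//; exact: metric_dim_real_lty.
Qed.
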